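(* Let $k$ be any positive integer, let $c>0$, and let $a_1>0$, $b_1>0$ be real numbers with $b_1/a_1<c$. Then there exist constants $\alpha,\beta$ with $0<\alpha<\beta<1-\alpha<1$ such that, setting $a_i=a_1(2-\alpha^{i-1})$ and $b_i=b_1\beta^{i-1}$ for $i=1,\ldots,k$, the function $$f(x,y)=\sum_{i=1}^k x^{a_i}y^{b_i}$$ is irreducible with witnessing exponents $z_i<c$; that is, for each $i\in\{1,\ldots,k\}$ there is a real $z_i$ with $0<z_i<c$ such that $a_iz_i+b_i>a_jz_i+b_j$ for all $j\neq i$ (so that along the valuations $x=y^{z_i}$ the $i$th term is not bounded by a constant multiple of the sum of the others).
   Context: Big-oh in two variables: for real functions $f(n_1,n_2)$ and $g(n_1,n_2)$ of nonnegative arguments, $f(n_1,n_2)=O(g(n_1,n_2))$ means there exist positive constants $c$, $n_{1,0}$, $n_{2,0}$ such that $f(n_1,n_2)\le c\,g(n_1,n_2)$ for all $n_1,n_2\ge 0$ satisfying $n_1\ge n_{1,0}$ or $n_2\ge n_{2,0}$. A term is a product of single-variable functions (here each $x^{a_i}y^{b_i}$). Given terms $T_1,\ldots,T_k$ and $S=T_1+\cdots+T_k$, the term $T_i$ is independent with respect to $S$ if $T_i=O(S-T_i)$ does not hold; $S$ is irreducible if every $T_i$ is independent with respect to $S$. Independence of the $i$th term is witnessed by a valuation $x=y^{z_i}$ with $z_i>0$ under which the exponent $a_iz_i+b_i$ of $y$ in the $i$th term strictly exceeds $a_jz_i+b_j$ for every $j\ne i$. *)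

(* Defs.v *)
From HB Require Import structures.
From mathcomp Require Import all_boot all_order all_algebra.
From mathcomp Require Import all_classical all_reals all_analysis.

Set Implicit Arguments.
Unset Strict Implicit.
Unset Printing Implicit Defensive.

Import Order.TTheory GRing.Theory Num.Theory.
Local Open Scope ring_scope.

(* The "or" below is essential: the bound is required outside a bounded box,
   not only when both arguments are large. *)
Definition bigO2 (R : realType) (f g : R -> R -> R) : Prop :=
  exists c n10 n20 : R, [/\ 0 < c, 0 < n10, 0 < n20 &
    forall n1 n2 : R, 0 <= n1 -> 0 <= n2 -> n10 <= n1 \/ n20 <= n2 ->
      f n1 n2 <= c * g n1 n2].

Record term (R : realType) := Term { xfactor : R -> R ; yfactor : R -> R }.

Definition term_eval (R : realType) (T : term R) (x y : R) : R :=
  xfactor T x * yfactor T y.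

Definition sum_terms (R : realType) (k : nat) (T : 'I_k -> term R) (x y : R) : R :=
  \sum_(i < k) term_eval (T i) x y.

Definition other_terms (R : realType) (k : nat) (T : 'I_k -> term R) (i : 'I_k)
    (x y : R) : R :=
  sum_terms T x y - term_eval (T i) x y.

Definition independent_term (R : realType) (k : nat) (T : 'I_k -> term R)
    (i : 'I_k) : Prop :=
  ~ bigO2 (term_eval (T i)) (other_terms T i).

(* Irreducibility is a property of the presentation S = T_1 + ... + T_k, hence
   of the family of terms rather than of the function sum_terms T. *)
Definition irreducible_sum (R : realType) (k : nat) (T : 'I_k -> term R) : Prop :=
  forall i : 'I_k, independent_term T i.

(* The term x^a y^b.  For positive exponents, which is the only case of
   interest, 0 `^ a = 0, so the term is right on the boundary of the
   quadrant x, y >= 0 as well. *)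
Definition power_term (R : realType) (a b : R) : term R :=
  Term (fun x => x `^ a) (fun y => y `^ b).

(* Main.v *)
Require Import Defs.
From HB Require Import structures.
From mathcomp Require Import all_boot all_order all_algebra.
From mathcomp Require Import all_classical all_reals all_analysis.
From mathcomp Require Import ring lra.

Set Implicit Arguments.
Unset Strict Implicit.
Unset Printing Implicit Defensive.

Import Order.TTheory GRing.Theory Num.Theory.
Local Open Scope ring_scope.

(* Put [q = beta / alpha > 1] and [z = (b1 / a1) w].  Then
   [a_j z + b_j = b1 (2 w + h j)] with [h j = beta ^ j - w alpha ^ j], and
   [h (j+1) - h j] has the sign of [w (1 - alpha) / (1 - beta) - q ^ j].
   Hence [h] is unimodal, with its strict maximum at [i] as soon as
   [w (1 - alpha) / (1 - beta)] lies strictly between [q ^ (i-1)] and [q ^ i].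
   All the values of [w] used are below [q ^ k], and since [b1 / a1 < c] one can
   take [q] so close to [1] that [(b1 / a1) q ^ k < c].  Finally, along
   [x = y ^ z] every other term is smaller than the [i]th one by a fixed
   positive power of [y]. *)

Lemma unimodal_lt_peak (R : realType) (h : nat -> R) (i j : nat) :
  (forall l, (l < i)%N -> h l < h l.+1) ->
  (forall l, (i <= l)%N -> h l.+1 < h l) ->
  j != i -> h j < h i.
Proof.
move=> up down; case: ltngtP => // [ji|ij] _.
- suff : forall m, (j < m <= i)%N -> h j < h m by apply; rewrite ji leqnn.
  elim=> // m IH /andP[]; rewrite ltnS leq_eqVlt => /orP[/eqP <-|jm] mi.
    exact: up.
  by rewrite (lt_trans (IH _) (up _ mi))// jm ltnW.
- elim: j ij => // m IH; rewrite ltnS leq_eqVlt => /orP[/eqP <-|im].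
    exact: down.
  by rewrite (lt_trans (down _ (ltnW im)))// IH.
Qed.

(** With [beta = alpha * q], the number [v] is the threshold [w (1 - alpha) / (1 - beta)]: each
    increment is [alpha ^+ l * (1 - beta) * (v - q ^+ l)], so it changes sign exactly at [i]. *)
Lemma geometric_difference_peak (R : realType) (alpha q w v : R) (i j : nat) :
  0 < alpha -> alpha * q < 1 -> w * (1 - alpha) = (1 - alpha * q) * v ->
  (forall l, (l < i)%N -> q ^+ l < v) -> (forall l, (i <= l)%N -> v < q ^+ l) ->
  j != i ->
  (alpha * q) ^+ j - w * alpha ^+ j < (alpha * q) ^+ i - w * alpha ^+ i.
Proof.
move=> alpha0 beta1 wv qltv vltq.
pose h l := (alpha * q) ^+ l - w * alpha ^+ l; apply: (@unimodal_lt_peak _ h).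
all: have step l : h l.+1 - h l = alpha ^+ l * (1 - alpha * q) * (v - q ^+ l).
all: try by rewrite -mulrA mulrBr -wv /h !exprS !exprMn; ring.
- move=> l /qltv qv; rewrite -subr_gt0 step.
  by rewrite !mulr_gt0 ?exprn_gt0 ?subr_gt0.
- move=> l /vltq qv; rewrite -subr_lt0 step.
  by rewrite pmulr_rlt0 ?subr_lt0// mulr_gt0 ?exprn_gt0 ?subr_gt0.
Qed.

Lemma exists_root_gt1 (R : realType) (M : R) (n : nat) :
  1 < M -> (0 < n)%N -> exists2 p : R, 1 < p & p ^+ n = M.
Proof.
move=> M1 n0; have M0 : 0 <= M by rewrite ltW// (lt_trans _ M1).
have pE : (M `^ n%:R^-1) ^+ n = M.
  rewrite -powR_mulrn ?powR_ge0// -powRrM mulVf ?powRr1//.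
  by rewrite pnatr_eq0 -lt0n.
exists (M `^ n%:R^-1) => //; rewrite ltNge; apply/negP => p1.
have : (M `^ n%:R^-1) ^+ n <= 1 by rewrite exprn_ile1// powR_ge0.
by rewrite pE leNgt M1.
Qed.

Lemma powR_dominant_not_bounded (R : realType) (I : finType) (e : I -> R)
    (i : I) :
  (forall j, j != i -> e j < e i) ->
  ~ (exists C y0 : R, forall y : R, 0 < y -> y0 <= y ->
       y `^ e i <= C * \sum_(j | j != i) y `^ e j).
Proof.
move=> dom [C [y0 bnd]].
(* The smallest exponent gap, capped at 1; the default 1 keeps [d] positive when there is no other
   index. *)
pose d : R := \big[Num.min/1]_(j | j != i) (e i - e j).
have d0 : 0 < d by apply: lt_bigmin => // j /dom; rewrite subr_gt0.
have dle j : j != i -> e j <= e i - d.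
  by move=> ji; rewrite lerBrDl -lerBrDr; exact: bigmin_le_cond.
(* [N] will be [y ^ d]. Its summands ensure, in turn, [1 <= y], a factor beating [C] times the
   number of terms, and [y0 <= y]. *)
pose N : R := 1 + `|C| * #|I|%:R + `|y0| `^ d.
have CI0 : 0 <= `|C| * #|I|%:R by rewrite mulr_ge0// ler0n.
have y0d : 0 <= `|y0| `^ d by exact: powR_ge0.
have N1 : 1 <= N by rewrite /N; lra.
have N0 : 0 < N by rewrite (lt_le_trans _ N1).
pose y := N `^ d^-1.
have yd : y `^ d = N by rewrite /y -powRrM mulVf ?gt_eqF// powRr1// ltW.
have y_gt0 : 0 < y by exact: powR_gt0.
have dV0 : 0 <= d^-1 by rewrite invr_ge0 ltW.
have y1 : 1 <= y.
  have -> : 1 = 1 `^ d^-1 :> R by rewrite powR1.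
  by apply: ge0_ler_powR; rewrite ?nnegrE// ltW.
have yy0 : y0 <= y.
  rewrite (le_trans (ler_norm y0))//.
  rewrite -[leLHS](@powRr1 _ `|y0|)// -(divff (lt0r_neq0 d0)) powRrM.
  apply: ge0_ler_powR => //; rewrite ?nnegrE//; first exact: ltW.
  by rewrite /N; lra.
have sum_le : \sum_(j | j != i) y `^ e j <= #|I|%:R * y `^ (e i - d).
  rewrite -[#|I|]sum1_card natr_sum mulr_suml.
  rewrite [leRHS](bigID (fun j => j != i))/= -[leLHS]addr0 lerD//.
    by apply: ler_sum => j ji; rewrite mul1r; exact: ler_powR y1 _ _ (dle _ ji).
  by apply: sumr_ge0 => j _; rewrite mul1r powR_ge0.
have := bnd _ y_gt0 yy0; apply/negP; rewrite -ltNge.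
have sum0 : 0 <= \sum_(j | j != i) y `^ e j.
  by apply: sumr_ge0 => j _; exact: powR_ge0.
apply: (@le_lt_trans _ _ (`|C| * #|I|%:R * y `^ (e i - d))).
  rewrite -mulrA (@le_trans _ _ (`|C| * \sum_(j | j != i) y `^ e j))//.
    by rewrite ler_wpM2r// ler_norm.
  by rewrite ler_wpM2l.
have -> : y `^ e i = N * y `^ (e i - d).
  rewrite -yd -powRD; last by rewrite (gt_eqF y_gt0) implybT.
  by congr (_ `^ _); ring.
by rewrite ltr_pM2r ?powR_gt0// /N; lra.
Qed.

Lemma power_term_curve (R : realType) (a b z y : R) : 0 < y ->
  term_eval (power_term a b) (y `^ z) y = y `^ (a * z + b).
Proof.
move=> y0; rewrite /term_eval /= -powRrM [z * a]mulrC -powRD//.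
by rewrite (gt_eqF y0) implybT.
Qed.

Lemma not_bounded_on_curve (R : realType) (k : nat) (a b : 'I_k -> R)
    (i : 'I_k) (z : R) :
  let T (j : 'I_k) := power_term (a j) (b j) in
  (forall j, j != i -> a j * z + b j < a i * z + b i) ->
  ~ (exists C y0 : R, forall y : R, 0 < y -> y0 <= y ->
       term_eval (T i) (y `^ z) y <= C * other_terms T i (y `^ z) y).
Proof.
move=> T /(@powR_dominant_not_bounded _ _ (fun j => a j * z + b j)) nbnd.
move=> [C [y0 bnd]]; apply: nbnd; exists C, y0 => y y_gt0 y0y.
have := bnd _ y_gt0 y0y; rewrite /other_terms /sum_terms (bigD1 i)//=.
rewrite addrAC subrr add0r power_term_curve//.
by under eq_bigr do rewrite power_term_curve//.
Qed.

(** The disjunction in [bigO2] makes [n2 <= y] alone sufficient to apply the bound at [(y ^ z, y)],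
    whatever the size of [y ^ z]. *)
Lemma independent_of_curve (R : realType) (k : nat) (T : 'I_k -> term R)
    (i : 'I_k) (z : R) :
  ~ (exists C y0 : R, forall y : R, 0 < y -> y0 <= y ->
       term_eval (T i) (y `^ z) y <= C * other_terms T i (y `^ z) y) ->
  independent_term T i.
Proof.
move=> nbnd [C [n1 [n2 [_ _ _ bnd]]]]; apply: nbnd; exists C, n2 => y y0 yn2.
by apply: bnd; [exact: powR_ge0|exact: ltW|right].
Qed.

(* The index i : 'I_k is zero-based: it stands for the index i + 1 of the
   informal statement. *)
Theorem theorem3 (R : realType) (k : nat) (c a1 b1 : R)
    (hk : (0 < k)%N) (hc : 0 < c) (ha1 : 0 < a1) (hb1 : 0 < b1)
    (hba : b1 / a1 < c) :
  exists alpha beta : R,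
    [/\ 0 < alpha, alpha < beta, beta < 1 - alpha & 1 - alpha < 1] /\
    let a (i : 'I_k) := a1 * (2 - alpha ^+ i) in
    let b (i : 'I_k) := b1 * beta ^+ i in
    let T (i : 'I_k) := power_term (a i) (b i) in
    irreducible_sum T /\
    forall i : 'I_k, exists z : R,
      [/\ 0 < z, z < c,
          (forall j : 'I_k, j != i -> a j * z + b j < a i * z + b i) &
          (* along x = y ^ z, T_i is not O(S - T_i) as y tends to infinity *)
          ~ (exists C y0 : R, forall y : R, 0 < y -> y0 <= y ->
               term_eval (T i) (y `^ z) y <= C * other_terms T i (y `^ z) y)].
Proof.
(* The first entry yields [z < c] from [w < M]; the cap 2 keeps [beta] at most 1/2, below
   [1 - alpha = 3/4]. *)
pose M := Num.min (a1 * c / b1) 2.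
have M1 : 1 < M.
  by rewrite lt_min ltr1n andbT ltr_pdivlMr// mul1r -ltr_pdivrMl// mulrC.
have M2 : M <= 2 by rewrite ge_min lexx orbT.
have Mc : M <= a1 * c / b1 by rewrite ge_min lexx.
(* [p] is the square root of the ratio [q]; the exponent [2 * k + 1] puts every [q ^ i] with [i < k]
   below [M]. *)
have [p p1 pM] := exists_root_gt1 M1 (ltn0Sn (2 * k)).
have p0 : 0 < p by rewrite (lt_trans _ p1).
have q1 : 1 < p ^+ 2 by rewrite exprn_egt1.
have q2 : p ^+ 2 <= 2.
  by rewrite (le_trans _ M2)// -pM ler_eXn2l// (leq_trans _ (leqnSn _))// leq_pmulr.
pose alpha : R := 4^-1.
have alphaE : alpha * 4 = 1 by rewrite mulVf// pnatr_eq0.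
pose beta := alpha * p ^+ 2.
exists alpha, beta; split; first by rewrite /beta; split; nra.
have beta1 : 0 < 1 - beta by rewrite /beta; nra.
have alpha1 : 0 < 1 - alpha by lra.
move=> a b T.
have witness (i : 'I_k) : exists z : R, [/\ 0 < z, z < c &
    forall j : 'I_k, j != i -> a j * z + b j < a i * z + b i].
  (* [v = q ^ (i - 1/2)], as [q = p ^ 2] *)
  pose v := p ^+ (2 * i) / p.
  pose w := (1 - beta) * v / (1 - alpha).
  have v0 : 0 < v by rewrite divr_gt0// exprn_gt0.
  have wE : w * (1 - alpha) = (1 - beta) * v by rewrite mulfVK// gt_eqF.
  have w0 : 0 < w by rewrite divr_gt0// mulr_gt0.
  have vlt l : (i <= l)%N -> v < p ^+ 2 ^+ l.
    move=> il; rewrite -exprM ltr_pdivrMr// -exprSr ltr_eXn2l// ltnS.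
    by rewrite leq_mul2l.
  (* Clearing the division by [p] leaves [2 * l + 1 < 2 * i], which holds since [l + 1 <= i]. *)
  have ltv l : (l < i)%N -> p ^+ 2 ^+ l < v.
    move=> li; rewrite -exprM ltr_pdivlMr// -exprSr ltr_eXn2l//.
    by rewrite (@leq_trans (2 * l.+1))// ?leq_mul2l// mulnS.
  (* Since [alpha < beta], the factor [(1 - beta) / (1 - alpha)] is below 1. *)
  have wv : w <= v by rewrite ler_pdivrMr// mulrC ler_pM2l// /beta; nra.
  have wM : w < M.
    rewrite (le_lt_trans wv)// (lt_le_trans (vlt _ (leqnn _)))// -pM -exprM.
    by rewrite ler_eXn2l// ltnW// ltnS leq_mul2l/= ltnW.
  exists (b1 * w / a1); split.
  - by rewrite divr_gt0// mulr_gt0.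
  - rewrite ltr_pdivrMr// [c * _]mulrC [b1 * _]mulrC -ltr_pdivlMr//.
    exact: lt_le_trans Mc.
  - move=> j ji.
    have abE l : a l * (b1 * w / a1) + b l =
        b1 * (2 * w + (beta ^+ l - w * alpha ^+ l)).
      by rewrite /a /b; field; rewrite gt_eqF.
    rewrite !abE ltr_pM2l// ltrD2l.
    by apply: (@geometric_difference_peak _ alpha _ _ v) => //; [lra|rewrite -subr_gt0].
split=> [i|i]; have [z [z0 zc peak]] := witness i.
  exact/independent_of_curve/(not_bounded_on_curve peak).
by exists z; split=> //; exact: not_bounded_on_curve.
Qed.
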